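(* Let $\Phi:\mathbb{D}\to\mathbb{R}^3$ be a conformal Willmore immersion with conformal Gauss map $Y$ (a column vector in $\mathbb{R}^5$). Let $$\mu=\big(\nabla Y_i\,Y_j-Y_i\nabla Y_j\big)_{1\le i,j\le5}=\nabla Y\,Y^T-Y\,\nabla Y^T .$$ Then $$2\mu=\begin{pmatrix}U&-\frac{V_{\mathrm{tra}}-V_{\mathrm{inv}}}{2}&\frac{V_{\mathrm{tra}}+V_{\mathrm{inv}}}{2}\\ \left(\frac{V_{\mathrm{tra}}-V_{\mathrm{inv}}}{2}\right)^T&0&V_{\mathrm{dil}}\\ -\left(\frac{V_{\mathrm{inv}}+V_{\mathrm{tra}}}{2}\right)^T&-V_{\mathrm{dil}}&0\end{pmatrix},$$ where $$U=\begin{pmatrix}0&-\tilde V_{\mathrm{rot}\,3}&\tilde V_{\mathrm{rot}\,2}\\ \tilde V_{\mathrm{rot}\,3}&0&-\tilde V_{\mathrm{rot}\,1}\\ -\tilde V_{\mathrm{rot}\,2}&\tilde V_{\mathrm{rot}\,1}&0\end{pmatrix},\qquad \tilde V_{\mathrm{rot}}=V_{\mathrm{rot}}+2\nabla^\perp\vec n .$$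
   Context: $\mathbb{D}$ is the unit disk with coordinates $(x,y)$, $z=x+iy$; $\nabla=(\partial_x,\partial_y)$, $\nabla^\perp=(-\partial_y,\partial_x)$. Quantities such as $\nabla Y$, $\mu$, $V_{\mathrm{tra}}$ are pairs (one component for each derivative), and all algebraic operations (products, cross products $\times$ in $\mathbb{R}^3$, scalar products) act componentwise on these pairs. For a smooth conformal immersion $\Phi:\mathbb{D}\to\mathbb{R}^3$: $e^{2\lambda}=2\langle\Phi_z,\Phi_{\bar z}\rangle=|\Phi_x|^2$, $\vec n=e^{-2\lambda}\Phi_x\times\Phi_y$, $H=2e^{-2\lambda}\langle\Phi_{z\bar z},\vec n\rangle$, $\vec H=H\vec n$, $\Omega=2\langle\Phi_{zz},\vec n\rangle$. Writing $e^{-2\lambda}\langle\nabla^2\Phi,\vec n\rangle=\begin{pmatrix}\epsilon&\varphi\\ \varphi&\gamma\end{pmatrix}$, the tracefree second fundamental form is $\mathring A=\begin{pmatrix}\frac{\epsilon-\gamma}{2}&\varphi\\ \varphi&\frac{\gamma-\epsilon}{2}\end{pmatrix}$ and $\mathring A\nabla\Phi=\left(\frac{\epsilon-\gamma}{2}\Phi_x+\varphi\Phi_y,\ \varphi\Phi_x-\frac{\epsilon-\gamma}{2}\Phi_y\right)$. $\pi_{\vec n}$ is the orthogonal projection onto $\mathbb{R}\vec n$. $\Phi$ is Willmore if $H_{z\bar z}+\frac{|\Omega|^2e^{-2\lambda}}{2}H=0$. Conformal Gauss map: $Y=H\begin{pmatrix}\Phi\\ \frac{|\Phi|^2-1}{2}\\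 \frac{|\Phi|^2+1}{2}\end{pmatrix}+\begin{pmatrix}\vec n\\ \langle\vec n,\Phi\rangle\\ \langle\vec n,\Phi\rangle\end{pmatrix}$. Conserved quantities: $$V_{\mathrm{tra}}=\nabla\vec H-3\pi_{\vec n}(\nabla\vec H)+\nabla^\perp\vec n\times\vec H,\qquad V_{\mathrm{dil}}=\langle V_{\mathrm{tra}},\Phi\rangle,\qquad V_{\mathrm{rot}}=\Phi\times V_{\mathrm{tra}}+2H\nabla^\perp\Phi,$$ $$V_{\mathrm{inv}}=|\Phi|^2V_{\mathrm{tra}}-2V_{\mathrm{dil}}\Phi+4\,\Phi\times(\vec n\times\mathring A\nabla\Phi).$$ *)

(* Defs.v *)
From HB Require Import structures.
From mathcomp Require Import all_boot all_order all_algebra.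
From mathcomp Require Import all_classical all_reals all_analysis.
From mathcomp Require Import complex.

Set Implicit Arguments.
Unset Strict Implicit.
Unset Printing Implicit Defensive.

Import Order.TTheory GRing.Theory Num.Theory.
Import numFieldNormedType.Exports.

Local Open Scope classical_set_scope.
Local Open Scope complex_scope.
Local Open Scope ring_scope.

(* Maps on the disk are total functions on R * R; hypotheses and conclusions
   only concern points of the (open) disk, where derivatives are local. *)
Definition disk (R : realType) : set (R * R) :=
  [set p | p.1 ^+ 2 + p.2 ^+ 2 < 1].

(* A pair (one component per derivative) is a function of k : 'I_2, with k = 0
   for the x-component and k = 1 for the y-component. *)
Definition dir (R : realType) (k : 'I_2) : R * R :=
  if k == 0 then (1, 0) else (0, 1).

Definition grad (R : realType) (V : normedModType R) (f : R * R -> V)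
    (p : R * R) (k : 'I_2) : V :=
  'D_(dir R k) f p.

Definition gradperp (R : realType) (V : normedModType R) (f : R * R -> V)
    (p : R * R) (k : 'I_2) : V :=
  if k == 0 then - grad f p 1 else grad f p 0.

Fixpoint class_C (R : realType) (V : normedModType R) (m : nat)
    (f : R * R -> V) : Prop :=
  match m with
  | 0%N => forall p, disk p -> {for p, continuous f}
  | m'.+1 => (forall p, disk p -> differentiable f p) /\
             forall k : 'I_2, class_C m' (fun p => grad f p k)
  end.

Definition smooth (R : realType) (V : normedModType R) (f : R * R -> V) : Prop :=
  forall m, class_C m f.

(* Bilinear (not Hermitian) when K is the field of complex numbers. The norm
   that the library puts on matrices is the sup norm, so |v|^2 is dot v v. *)
Definition dot (K : comNzRingType) (u v : 'cV[K]_3) : K := (u^T *m v) 0 0.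

Definition cross (K : comNzRingType) (u v : 'cV[K]_3) : 'cV[K]_3 :=
  \col_i nth 0 [:: u 1 0 * v 2 0 - u 2 0 * v 1 0;
                   u 2 0 * v 0 0 - u 0 0 * v 2 0;
                   u 0 0 * v 1 0 - u 1 0 * v 0 0] i.

Definition proj_line (R : realType) (n v : 'cV[R]_3) : 'cV[R]_3 :=
  (dot v n / dot n n) *: n.

(* Real directional derivative of a complex-valued function *)
Definition cderive (R : realType) (f : R * R -> R[i]) (p : R * R) (k : 'I_2) :
    R[i] :=
  grad (fun q => complex.Re (f q)) p k +i* grad (fun q => complex.Im (f q)) p k.

Definition dz (R : realType) (f : R * R -> R[i]) (p : R * R) : R[i] :=
  (cderive f p 0 - (0 +i* 1) * cderive f p 1) / 2.

Definition dzbar (R : realType) (f : R * R -> R[i]) (p : R * R) : R[i] :=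
  (cderive f p 0 + (0 +i* 1) * cderive f p 1) / 2.

Definition vdz (R : realType) (F : R * R -> 'cV[R[i]]_3) (p : R * R) :
    'cV[R[i]]_3 :=
  \col_i dz (fun q => F q i 0) p.

Definition vdzbar (R : realType) (F : R * R -> 'cV[R[i]]_3) (p : R * R) :
    'cV[R[i]]_3 :=
  \col_i dzbar (fun q => F q i 0) p.

Definition toC (R : realType) (v : 'cV[R]_3) : 'cV[R[i]]_3 :=
  map_mx (real_complex R) v.

Section Surface.
Variables (R : realType) (Phi : R * R -> 'cV[R]_3).
Implicit Types (p : R * R) (k : 'I_2).

Definition conformal_immersion : Prop :=
  [/\ smooth Phi,
      forall p, disk p -> injective ('d Phi p) &
      forall p, disk p ->
        dot (grad Phi p 0) (grad Phi p 0) = dot (grad Phi p 1) (grad Phi p 1) /\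
        dot (grad Phi p 0) (grad Phi p 1) = 0].

(* e^(2 lambda) *)
Definition e2lambda p : R := dot (grad Phi p 0) (grad Phi p 0).

Definition normal p : 'cV[R]_3 :=
  (e2lambda p)^-1 *: cross (grad Phi p 0) (grad Phi p 1).

(* Phi_(z zbar) is a quarter of the Laplacian of Phi, hence real: Re only
   serves to land in R. *)
Definition meanH p : R :=
  complex.Re (2 * ((e2lambda p)^-1)%:C
    * dot (vdzbar (vdz (fun q => toC (Phi q))) p) (toC (normal p))).

Definition vecH p : 'cV[R]_3 := meanH p *: normal p.

Definition Omega p : R[i] :=
  2 * dot (vdz (vdz (fun q => toC (Phi q))) p) (toC (normal p)).

Definition willmore : Prop :=
  forall p, disk p ->
    dzbar (dz (fun q => (meanH q)%:C)) p
    + `|Omega p| ^+ 2 * ((e2lambda p)^-1)%:C / 2 * (meanH p)%:C = 0.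

(* e^(-2 lambda) <nabla^2 Phi, n> = ((epsilon, phi), (phi, gamma)) *)
Definition sff p (k l : 'I_2) : R :=
  (e2lambda p)^-1 * dot (grad (fun q => grad Phi q k) p l) (normal p).

Definition A0 p : 'M[R]_2 :=
  let epsilon := sff p 0 0 in
  let phi := sff p 0 1 in
  let gamma := sff p 1 1 in
  \matrix_(k, l) nth 0 (nth [::] [:: [:: (epsilon - gamma) / 2; phi];
                                     [:: phi; (gamma - epsilon) / 2]] k) l.

Definition A0grad p k : 'cV[R]_3 :=
  A0 p k 0 *: grad Phi p 0 + A0 p k 1 *: grad Phi p 1.

Definition gaussY p : 'cV[R]_5 :=
  meanH p *: col_mx (Phi p)
               (col_mx ((dot (Phi p) (Phi p) - 1) / 2)%:M
                       ((dot (Phi p) (Phi p) + 1) / 2)%:M)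
  + col_mx (normal p)
      (col_mx (dot (normal p) (Phi p))%:M (dot (normal p) (Phi p))%:M).

Definition mu p k : 'M[R]_5 :=
  grad gaussY p k *m (gaussY p)^T - gaussY p *m (grad gaussY p k)^T.

Definition Vtra p k : 'cV[R]_3 :=
  grad vecH p k - 3 *: proj_line (normal p) (grad vecH p k)
  + cross (gradperp normal p k) (vecH p).

Definition Vdil p k : R := dot (Vtra p k) (Phi p).

Definition Vrot p k : 'cV[R]_3 :=
  cross (Phi p) (Vtra p k) + (2 * meanH p) *: gradperp Phi p k.

Definition Vinv p k : 'cV[R]_3 :=
  dot (Phi p) (Phi p) *: Vtra p k - (2 * Vdil p k) *: Phi p
  + 4 *: cross (Phi p) (cross (normal p) (A0grad p k)).

Definition Vrot_tilde p k : 'cV[R]_3 :=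
  Vrot p k + 2 *: gradperp normal p k.

Definition Umx p k : 'M[R]_3 :=
  let v := Vrot_tilde p k in
  \matrix_(i, j) nth 0 (nth [::] [:: [:: 0; - v 2 0; v 1 0];
                                     [:: v 2 0; 0; - v 0 0];
                                     [:: - v 1 0; v 0 0; 0]] i) j.

End Surface.

(* Main.v *)
(** Both sides are pointwise algebraic expressions in the 1-jet of [Phi], [n] and
    [H]. Write [w] for the tangential vector [A0grad]. The Weingarten equation
    [grad n = - (H grad Phi + w)] and its rotated form
    [gradperp n = n x (H grad Phi - w)] give [Vtra = - 2 (grad H n + H w)]. In
    [grad Y] the terms [H grad Phi] cancel: its first three entries are
    [grad H Phi - w]. So [grad n] and [grad Phi] disappear from [mu], and each
    block is a polynomial identity in [Phi], [n], [w], [H], [grad H]. The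
    Weingarten equation uses the symmetry of the second derivatives of [Phi];
    conformality makes [Phi_x, Phi_y] an orthogonal frame of equal lengths. *)
Require Import Defs.
From mathcomp Require Import all_boot all_order all_algebra.
From mathcomp Require Import all_classical all_reals all_analysis.
From mathcomp Require Import complex ring lra.

Set Implicit Arguments.
Unset Strict Implicit.
Unset Printing Implicit Defensive.

Import Order.TTheory GRing.Theory Num.Theory.
Import numFieldNormedType.Exports.
Local Open Scope classical_set_scope.
Local Open Scope ring_scope.

(** * Coordinates, and the algebra of dot and cross products *)

Lemma ord3P (P : 'I_3 -> Prop) : P 0 -> P 1 -> P 2 -> forall i, P i.
Proof.
move=> P0 P1 P2 [[|[|[|//]]] Hi].
- by have -> : Ordinal Hi = 0 by exact: val_inj.
- by have -> : Ordinal Hi = 1 by exact: val_inj.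
- by have -> : Ordinal Hi = 2 by exact: val_inj.
Qed.

Lemma ord2P (P : 'I_2 -> Prop) : P 0 -> P 1 -> forall i, P i.
Proof.
move=> P0 P1 [[|[|//]] Hi].
- by have -> : Ordinal Hi = 0 by exact: val_inj.
- by have -> : Ordinal Hi = 1 by exact: val_inj.
Qed.

Lemma cV3_eq (T : Type) (u v : 'cV[T]_3) :
  u 0 0 = v 0 0 -> u 1 0 = v 1 0 -> u 2 0 = v 2 0 -> u = v.
Proof.
by move=> e0 e1 e2; apply/matrixP => i j; rewrite ord1; elim/ord3P: i.
Qed.

Section VectorAlgebra.
Variable K : comNzRingType.
Implicit Types u v w : 'cV[K]_3.

Lemma dotE u v : dot u v = u 0 0 * v 0 0 + u 1 0 * v 1 0 + u 2 0 * v 2 0.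
Proof.
rewrite /dot mxE !big_ord_recr big_ord0 /= add0r !mxE.
by congr (u _ 0 * v _ 0 + u _ 0 * v _ 0 + u _ 0 * v _ 0); apply: val_inj.
Qed.

Lemma dotC u v : dot u v = dot v u.
Proof. by rewrite !dotE; ring. Qed.

Lemma dotDl u v w : dot (u + v) w = dot u w + dot v w.
Proof. by rewrite !dotE !mxE; ring. Qed.

Lemma dotNl u v : dot (- u) v = - dot u v.
Proof. by rewrite !dotE !mxE; ring. Qed.

Lemma dotZl c u v : dot (c *: u) v = c * dot u v.
Proof. by rewrite !dotE !mxE; ring. Qed.

Lemma dotDr u v w : dot u (v + w) = dot u v + dot u w.
Proof. by rewrite !dotE !mxE; ring. Qed.

Lemma dotZr c u v : dot u (c *: v) = c * dot u v.
Proof. by rewrite !dotE !mxE; ring. Qed.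

Lemma dot_crossl u v : dot (cross u v) u = 0.
Proof. by rewrite !dotE !mxE /=; ring. Qed.

Lemma dot_crossr u v : dot (cross u v) v = 0.
Proof. by rewrite !dotE !mxE /=; ring. Qed.

Lemma crossC u v : cross u v = - cross v u.
Proof. by apply: cV3_eq; rewrite !mxE /=; ring. Qed.

Lemma crossZl c u v : cross (c *: u) v = c *: cross u v.
Proof. by apply: cV3_eq; rewrite !mxE /=; ring. Qed.

Lemma crossDr u v w : cross u (v + w) = cross u v + cross u w.
Proof. by apply: cV3_eq; rewrite !mxE /=; ring. Qed.

Lemma crossZr c u v : cross u (c *: v) = c *: cross u v.
Proof. by apply: cV3_eq; rewrite !mxE /=; ring. Qed.

Lemma crossNr u v : cross u (- v) = - cross u v.
Proof. by apply: cV3_eq; rewrite !mxE /=; ring. Qed.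

Lemma triple_product u v w : cross u (cross v w) = dot u w *: v - dot u v *: w.
Proof. by apply: cV3_eq; rewrite !dotE !mxE /=; ring. Qed.

Lemma lagrange_identity u v :
  dot (cross u v) (cross u v) = dot u u * dot v v - dot u v ^+ 2.
Proof. by rewrite !dotE !mxE /=; ring. Qed.

(** Cramer's rule in the basis [u], [v], [cross u v], multiplied through by the Gram determinant so
    that it is a polynomial identity over any commutative ring. *)
Lemma frame_expansion u v w :
  (dot u u * dot v v - dot u v ^+ 2) *: w =
  (dot v v * dot w u - dot u v * dot w v) *: u
  + (dot u u * dot w v - dot u v * dot w u) *: v
  + dot w (cross u v) *: cross u v.
Proof. by apply: cV3_eq; rewrite !dotE !mxE /=; ring. Qed.

End VectorAlgebra.

Lemma conformal_frame_expansion (K : fieldType) (E x y : K) (u v w : 'cV[K]_3) :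
  E != 0 -> dot u u = E -> dot v v = E -> dot u v = 0 -> dot w (cross u v) = 0 ->
  dot w u = E * x -> dot w v = E * y -> w = x *: u + y *: v.
Proof.
move=> E0 uu vv uv wc wu wv; have := frame_expansion u v w.
(* The Gram determinant is now [E * E], and each coefficient on the right also carries two factors
   [E]; they are cancelled one at a time. *)
rewrite uu vv uv wc wu wv scale0r addr0 !mul0r !subr0 expr0n subr0 -!scalerA.
by rewrite -!scalerDr => /(scalerI E0)/(scalerI E0).
Qed.

(** The unit normal acts on the tangent plane as a quarter turn; the triple product formula computes
    both images. *)
Lemma cross_conformal_frame (K : fieldType) (E : K) (u v : 'cV[K]_3) :
  E != 0 -> dot u u = E -> dot v v = E -> dot u v = 0 ->
  cross (E^-1 *: cross u v) u = v /\ cross (E^-1 *: cross u v) v = - u.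
Proof.
move=> E0 uu vv uv; split; rewrite crossZl crossC triple_product.
  by rewrite uu uv scale0r sub0r opprK scalerA mulVf// scale1r.
by rewrite vv dotC uv scale0r subr0 scalerN scalerA mulVf// scale1r.
Qed.

Lemma dot_conformal_normal (K : fieldType) (E : K) (u v : 'cV[K]_3) :
  E != 0 -> dot u u = E -> dot v v = E -> dot u v = 0 ->
  dot (E^-1 *: cross u v) (E^-1 *: cross u v) = 1.
Proof.
by move=> E0 uu vv uv; rewrite dotZl dotZr lagrange_identity uu vv uv; field.
Qed.

(** * Directional derivatives of matrix-valued maps *)

Section Calculus.
Variables (R : realType) (V : normedModType R).

(** Restricting to a line leaves the difference quotient unchanged. This brings directional
    derivatives within reach of the one-variable mean value theorem. *)
Lemma is_derive_line (W : normedModType R) (f : V -> W) (x v : V) (s : R) (df : W) :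
  is_derive (x + s *: v) v f df ->
  is_derive s (1 : R) (fun t => f (x + t *: v)) df.
Proof.
have E : (fun h : R => h^-1 *: (((fun t => f (x + t *: v)) \o shift s) (h *: 1)
            - f (x + s *: v))) =
         (fun h : R => h^-1 *: ((f \o shift (x + s *: v)) (h *: v)
            - f (x + s *: v))).
  apply/funext => h /=.
  by rewrite [h *: 1]mulr1 scalerDl addrCA.
by case=> H1 H2; split; [rewrite /derivable E | rewrite /derive E].
Qed.

Lemma is_derive_mxP m n (M : V -> 'M[R]_(m, n)) x v dM :
  is_derive x v M dM <-> forall i j, is_derive x v (fun q => M q i j) (dM i j).
Proof.
split=> [[H1 H2] i j|H].
  split; first exact: (proj1 (derivable_mxP _ _ _)).
  by rewrite -H2 derive_mx// mxE.
have H1 : derivable M x v by apply/derivable_mxP => i j; apply: ex_derive.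
split=> //; rewrite derive_mx//; apply/matrixP => i j.
by rewrite mxE; apply: derive_val.
Qed.

Lemma is_derive_scalemx m n (f : V -> R) (M : V -> 'M[R]_(m, n)) x v df dM :
  is_derive x v f df -> is_derive x v M dM ->
  is_derive x v (fun q => f q *: M q) (df *: M x + f x *: dM).
Proof.
move=> Hf /is_derive_mxP HM; apply/is_derive_mxP => i j.
have -> : (fun q => (f q *: M q) i j) = (f * (fun q => M q i j))%R.
  by apply/funext => q; rewrite mxE.
apply: is_derive_eq (is_deriveM Hf (HM i j)) _.
by rewrite !mxE /GRing.scale /=; ring.
Qed.

Lemma is_derive_col_mx m1 m2 n (M : V -> 'M[R]_(m1, n)) (N : V -> 'M[R]_(m2, n))
    x v dM dN :
  is_derive x v M dM -> is_derive x v N dN ->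
  is_derive x v (fun q => col_mx (M q) (N q)) (col_mx dM dN).
Proof.
move=> /is_derive_mxP HM /is_derive_mxP HN; apply/is_derive_mxP => i j.
rewrite mxE.
have -> : (fun q => col_mx (M q) (N q) i j) =
   (fun q => match fintype.split i with inl k => M q k j | inr k => N q k j end).
  by apply/funext => q; rewrite mxE.
by case: fintype.split.
Qed.

Lemma is_derive_scalar_mx1 (f : V -> R) x v df :
  is_derive x v f df -> is_derive x v (fun q => (f q)%:M : 'M[R]_1) df%:M.
Proof.
move=> Hf; apply/is_derive_mxP => i j; rewrite !ord1 mxE mulr1n.
have E : (fun q => ((f q)%:M : 'M[R]_1) 0 0) = f :> (V -> R).
  by apply/funext => q; rewrite mxE mulr1n.
by rewrite E.
Qed.

Lemma is_derive_dot (F G : V -> 'cV[R]_3) x v dF dG :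
  is_derive x v F dF -> is_derive x v G dG ->
  is_derive x v (fun q => dot (F q) (G q)) (dot dF (G x) + dot (F x) dG).
Proof.
move=> /is_derive_mxP HF /is_derive_mxP HG.
have -> : (fun q => dot (F q) (G q)) =
  (fun q => F q 0 0) * (fun q => G q 0 0) + (fun q => F q 1 0) * (fun q => G q 1 0)
  + (fun q => F q 2 0) * (fun q => G q 2 0).
  by apply/funext => q; rewrite dotE.
apply: is_derive_eq (is_deriveD (is_deriveD (is_deriveM (HF 0 0) (HG 0 0))
  (is_deriveM (HF 1 0) (HG 1 0))) (is_deriveM (HF 2 0) (HG 2 0))) _.
by rewrite !dotE /GRing.scale /=; ring.
Qed.

(** Derivability suffices: the derivative of the normal is later recovered from its inner products
    with the frame, not from a product rule for [cross]. *)
Lemma derivable_cross (F G : V -> 'cV[R]_3) x v :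
  derivable F x v -> derivable G x v ->
  derivable (fun q => cross (F q) (G q)) x v.
Proof.
move=> /derivable_mxP HF /derivable_mxP HG; apply/derivable_mxP => i j.
have E a b c d k : (forall q, cross (F q) (G q) k j =
     F q a 0 * G q b 0 - F q c 0 * G q d 0) ->
   derivable (fun q => cross (F q) (G q) k j) x v.
  move=> Hq; have -> : (fun q => cross (F q) (G q) k j) =
      (fun q => F q a 0) * (fun q => G q b 0)
      - (fun q => F q c 0) * (fun q => G q d 0) by apply/funext => q; rewrite Hq.
  by apply: derivableB; apply: derivableM.
by elim/ord3P: i;
  [apply: (E 1 2 2 1)|apply: (E 2 0 0 2)|apply: (E 0 1 1 0)] => q; rewrite mxE.
Qed.

End Calculus.

(** * Symmetry of second derivatives *)

Section Schwarz.
Variables (R : realType) (V : normedModType R).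

(** The mean value theorem is applied twice: to the increment of [f] along [h *: v], as a function
    of the position [s] along [u], and then to [fu] along [v] at the point [s] so obtained. *)
Lemma second_difference (f fu fuv : V -> R) (p u v : V) (h : R) :
  0 < h ->
  (forall s t, 0 <= s <= h -> 0 <= t <= h ->
    is_derive (p + s *: u + t *: v) u f (fu (p + s *: u + t *: v)) /\
    is_derive (p + s *: u + t *: v) v fu (fuv (p + s *: u + t *: v))) ->
  exists s t, [/\ 0 <= s <= h, 0 <= t <= h &
    f (p + h *: u + h *: v) - f (p + h *: u) - (f (p + h *: v) - f p)
    = fuv (p + s *: u + t *: v) * h ^+ 2].
Proof.
move=> h0 H.
have h00 : 0 <= h <= h by rewrite ltW /=.
have z0 : 0 <= (0 : R) <= h by rewrite lexx ltW.
pose g (s : R) := f (p + h *: v + s *: u) - f (p + s *: u).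
pose dg (s : R) := fu (p + h *: v + s *: u) - fu (p + s *: u).
have Dg s : 0 <= s <= h -> is_derive s 1 g (dg s).
  move=> sh; apply: is_deriveB; apply: is_derive_line.
    by have [] := H s h sh h00; rewrite addrAC.
  by have [] := H s 0 sh z0; rewrite scale0r addr0.
have [||s] := @MVT _ g dg 0 h h0.
- by move=> s; rewrite in_itv /= => /andP[s0 sh]; apply: Dg; rewrite !ltW.
- apply: derivable_within_continuous => s; rewrite in_itv /= => sh.
  by apply: ex_derive; apply: Dg.
rewrite in_itv /= => /andP[s0 sh] Eg.
have sh' : 0 <= s <= h by rewrite !ltW.
pose k (t : R) := fu (p + s *: u + t *: v).
have Dk t : 0 <= t <= h -> is_derive t 1 k (fuv (p + s *: u + t *: v)).
  by move=> th; apply: is_derive_line; have [] := H s t sh' th.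
have [||t] := @MVT _ k (fun t => fuv (p + s *: u + t *: v)) 0 h h0.
- by move=> t; rewrite in_itv /= => /andP[t0 th]; apply: Dk; rewrite !ltW.
- apply: derivable_within_continuous => t; rewrite in_itv /= => th.
  by apply: ex_derive; apply: Dk.
rewrite in_itv /= => /andP[t0 th] Ek.
exists s, t; split; rewrite ?ltW//.
move: Eg Ek; rewrite /g /dg /k !scale0r !addr0 !subr0 => Eg Ek.
rewrite expr2 mulrA -Ek [p + s *: u + h *: v]addrAC -Eg [p + h *: u + h *: v]addrAC.
ring.
Qed.

(** The second difference is symmetric in [u] and [v]. Evaluating it in both orders gives two points
    near [p] at which [fuv] and [fvu] take the same value; continuity then puts [fuv p] and [fvu p]
    within any [e] of each other. *)
Lemma schwarz (f fu fv fuv fvu : V -> R) (p u v : V) :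
  (\forall q \near p, is_derive q u f (fu q)) ->
  (\forall q \near p, is_derive q v f (fv q)) ->
  (\forall q \near p, is_derive q v fu (fuv q)) ->
  (\forall q \near p, is_derive q u fv (fvu q)) ->
  {for p, continuous fuv} -> {for p, continuous fvu} ->
  fuv p = fvu p.
Proof.
move=> Hu Hv Huv Hvu cuv cvu; apply/eqP; rewrite -subr_eq0 -normr_eq0.
apply/eqP/le_anti; rewrite normr_ge0 andbT; apply/ler_addgt0Pr => e e0.
rewrite add0r.
have e20 : 0 < e / 2 by rewrite divr_gt0.
move/cvgrPdist_le : cuv => /(_ _ e20) cuv.
move/cvgrPdist_le : cvu => /(_ _ e20) cvu.
have /nbhs_ballP[d /= d0 Bd] : nbhs p (fun q : V =>
    (is_derive q u f (fu q) /\ is_derive q v fu (fuv q)) /\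
    (is_derive q v f (fv q) /\ is_derive q u fv (fvu q)) /\
    (`|fuv p - fuv q| <= e / 2 /\ `|fvu p - fvu q| <= e / 2)).
  exact: filterI (filterI Hu Huv) (filterI (filterI Hv Hvu) (filterI cuv cvu)).
(* Small enough for the whole parallelogram spanned by [h *: u] and [h *: v] to lie in the ball; the
   [+ 1] keeps the denominator positive when both vectors vanish. *)
pose h := d / (`|u| + `|v| + 1) / 2.
have n0 : 0 < `|u| + `|v| + 1 by rewrite ltr_wpDl// addr_ge0.
have h0 : 0 < h by rewrite !divr_gt0.
have hd : h * (`|u| + `|v|) < d.
  have -> : d = h * (`|u| + `|v| + 1) * 2 by rewrite /h; field; rewrite gt_eqF.
  have := mulr_ge0 (ltW h0) (addr_ge0 (normr_ge0 u) (normr_ge0 v)).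
  by nra.
have near_pt s t : 0 <= s <= h -> 0 <= t <= h -> ball p d (p + s *: u + t *: v).
  move=> /andP[s0 sh] /andP[t0 th]; rewrite -ball_normE /= -addrA opprD addNKr.
  rewrite normrN (le_lt_trans (ler_normD _ _))// !normrZ !ger0_norm//.
  by rewrite (le_lt_trans _ hd)// mulrDr lerD// ler_wpM2r.
have [s [t [sh th E1]]] : exists s t, [/\ 0 <= s <= h, 0 <= t <= h &
    f (p + h *: u + h *: v) - f (p + h *: u) - (f (p + h *: v) - f p)
    = fuv (p + s *: u + t *: v) * h ^+ 2].
  apply: (@second_difference f fu fuv p u v h h0) => s t sh th.
  by have [] := Bd _ (near_pt s t sh th).
have [t' [s' [th' sh' E2]]] : exists s t, [/\ 0 <= s <= h, 0 <= t <= h &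
    f (p + h *: v + h *: u) - f (p + h *: v) - (f (p + h *: u) - f p)
    = fvu (p + s *: v + t *: u) * h ^+ 2].
  apply: (@second_difference f fv fvu p v u h h0) => t' s' th' sh'.
  by rewrite addrAC; have [_ []] := Bd _ (near_pt s' t' sh' th').
have [_ [_ [C1 _]]] := Bd _ (near_pt s t sh th).
have [_ [_ [_ C2]]] := Bd _ (near_pt s' t' sh' th').
have E : fuv (p + s *: u + t *: v) = fvu (p + s' *: u + t' *: v).
  apply: (@mulIf _ (h ^+ 2)); first by rewrite expf_neq0 ?gt_eqF.
  by rewrite -E1 [p + s' *: u + _]addrAC -E2 [p + h *: v + _]addrAC; ring.
rewrite -(subrK (fuv (p + s *: u + t *: v)) (fuv p)) -addrA.
rewrite (le_trans (ler_normD _ _))// [leRHS]splitr lerD//.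
by rewrite E distrC.
Qed.

End Schwarz.

(** * Openness of the disk, and Wirtinger derivatives in real terms *)

Lemma near_disk (R : realType) (p : R * R) : disk p -> \forall q \near p, disk q.
Proof.
move=> dp; have cf : continuous (fun q : R * R => q.1 ^+ 2 + q.2 ^+ 2).
  by move=> q; apply: cvgD; apply: cvgM; first [exact: cvg_fst|exact: cvg_snd].
exact: (cf p _ (lt_nbhsl dp)).
Qed.

Section ComplexDerivatives.
Variable R : realType.
Implicit Types (f : R * R -> R[i]) (p : R * R).

Lemma dzE f p :
  let dRe := grad (fun q => complex.Re (f q)) p in
  let dIm := grad (fun q => complex.Im (f q)) p in
  dz f p = Complex ((dRe 0 + dIm 1) / 2) ((dIm 0 - dRe 1) / 2).
Proof.
move=> dRe dIm; rewrite /dz; apply: (canLR (mulfK _)); first by rewrite pnatr_eq0.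
(* The numeral 2 is rewritten as an embedded real, so that [simpc] can split real and imaginary
   parts. *)
rewrite -(rmorph_nat (real_complex R) 2) /cderive -/dRe -/dIm.
by simpc; congr Complex; field.
Qed.

Lemma dzbarE f p :
  let dRe := grad (fun q => complex.Re (f q)) p in
  let dIm := grad (fun q => complex.Im (f q)) p in
  dzbar f p = Complex ((dRe 0 - dIm 1) / 2) ((dIm 0 + dRe 1) / 2).
Proof.
move=> dRe dIm; rewrite /dzbar; apply: (canLR (mulfK _)); first by rewrite pnatr_eq0.
rewrite -(rmorph_nat (real_complex R) 2) /cderive -/dRe -/dIm.
by simpc; congr Complex; field.
Qed.

Lemma Re_dot_toC (w : 'cV[R[i]]_3) (v : 'cV[R]_3) :
  complex.Re (dot w (toC v)) = dot (\col_i complex.Re (w i 0)) v.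
Proof.
rewrite !dotE !mxE.
by case: (w 0 0) (w 1 0) (w 2 0) => [a b] [c d] [e f] /=; simpc => /=; ring.
Qed.

End ComplexDerivatives.

(** * Regularity of the immersion, its normal and its mean curvature *)

Section Surface.
Variables (R : realType) (Phi : R * R -> 'cV[R]_3).
Hypothesis hPhi : conformal_immersion Phi.
Implicit Types (p q : R * R) (k l : 'I_2).

Lemma differentiable_Phi p : disk p -> differentiable Phi p.
Proof. by case: hPhi => /(_ 1%N) [H _] _ _; exact: H. Qed.

Lemma is_derive_Phi p k : disk p -> is_derive p (dir R k) Phi (grad Phi p k).
Proof. by move=> dp; apply/derivableP/diff_derivable/differentiable_Phi. Qed.

Lemma is_derive_grad p k l : disk p ->
  is_derive p (dir R l) (fun q => grad Phi q k) (grad (fun q => grad Phi q k) p l).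
Proof.
case: hPhi => /(_ 2%N) [_ H] _ _ dp; apply/derivableP/diff_derivable.
by have [+ _] := H k; apply.
Qed.

(** Third-order smoothness serves twice: it makes the second derivatives continuous, as Schwarz
    requires, and it makes [meanH] derivable. *)
Lemma differentiable_hess p k l : disk p ->
  differentiable (fun q => grad (fun q => grad Phi q k) q l) p.
Proof.
case: hPhi => /(_ 3%N) [_ H] _ _ dp.
by have [_ /(_ l) [+ _]] := H k; apply.
Qed.

Lemma hess_sym p : disk p ->
  grad (fun q => grad Phi q 0) p 1 = grad (fun q => grad Phi q 1) p 0.
Proof.
move=> dp; apply/matrixP => i j.
have D k l : {for p, continuous (fun q => grad (fun q => grad Phi q k) q l i j)}.
  apply: (@continuous_comp _ _ _ (fun q => grad (fun q => grad Phi q k) q l)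
    (fun M : 'cV[R]_3 => M i j)).
    exact/differentiable_continuous/differentiable_hess.
  exact: coord_continuous.
have DP k : \forall q \near p,
    is_derive q (dir R k) (fun r => Phi r i j) (grad Phi q k i j).
  apply: filterS (near_disk dp) => q dq.
  exact: (proj1 (is_derive_mxP _ _ _ _) (is_derive_Phi _ dq)).
have DDP k l : \forall q \near p, is_derive q (dir R l)
    (fun r => grad Phi r k i j) (grad (fun r => grad Phi r k) q l i j).
  apply: filterS (near_disk dp) => q dq.
  exact: (proj1 (is_derive_mxP _ _ _ _) (is_derive_grad _ _ dq)).
exact: (schwarz (DP 0) (DP 1) (DDP 0 1) (DDP 1 0) (D 0 1) (D 1 0)).
Qed.

(** If the conformal factor vanished, so would [Phi_x], and the differential would send [(1, 0)] and
    [0] to the same vector, against injectivity. *)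
Lemma e2lambda_neq0 p : disk p -> e2lambda Phi p != 0.
Proof.
move=> dp; apply/eqP; rewrite /e2lambda dotE => E.
have [_ /(_ p dp) inj _] := hPhi.
have g0 : grad Phi p 0 = 0.
  by apply: cV3_eq; rewrite mxE; nra.
have : ('d Phi p : R * R -> _) (1, 0) = 'd Phi p 0.
  rewrite linear0 -g0 /grad deriveE//; exact: differentiable_Phi.
by move/inj => [/eqP]; rewrite oner_eq0.
Qed.

Lemma grad_coord p k i : disk p ->
  grad (fun q => Phi q i 0) p k = grad Phi p k i 0.
Proof.
move=> dp; apply: derive_val.
exact: (proj1 (is_derive_mxP _ _ _ _) (is_derive_Phi _ dp)).
Qed.

Lemma Re_laplacian p i : disk p ->
  complex.Re (vdzbar (vdz (fun q => toC (Phi q))) p i 0) =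
  (grad (fun q => grad Phi q 0) p 0 + grad (fun q => grad Phi q 1) p 1) i 0 / 4.
Proof.
move=> dp; rewrite mxE dzbarE /=.
have E q : disk q -> vdz (fun q => toC (Phi q)) q i 0 =
   Complex (grad Phi q 0 i 0 / 2) (- grad Phi q 1 i 0 / 2).
  move=> dq; rewrite mxE dzE /=.
  have -> : (fun q => complex.Re (toC (Phi q) i 0)) = (fun q => Phi q i 0).
    by apply/funext => r; rewrite mxE.
  have -> : (fun q => complex.Im (toC (Phi q) i 0)) = cst 0.
    by apply/funext => r; rewrite mxE.
  by rewrite !grad_coord// /grad !derive_cst addr0 sub0r.
(* Only the pure second derivatives enter the real part, so a single index [k] serves for both
   differentiations. *)
have D k c : grad (fun q => grad Phi q k i 0 * c) p k =
    grad (fun q => grad Phi q k) p k i 0 * c.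
  apply: derive_val; have /is_derive_mxP/(_ i 0) H := is_derive_grad k k dp.
  have -> : (fun q => grad Phi q k i 0 * c) = c \*: (fun q => grad Phi q k i 0).
    by apply/funext => q; rewrite /= mulrC.
  by apply: is_derive_eq; rewrite mulrC.
(* [E] holds on the disk only; it is used under the derivative through equality near [p]. *)
have -> : grad (fun q => complex.Re (vdz (fun q => toC (Phi q)) q i 0)) p 0 =
    grad (fun q => grad Phi q 0 i 0 * 2^-1) p 0.
  apply: near_eq_derive; apply: filterS (near_disk dp) => q dq.
  by rewrite E.
have -> : grad (fun q => complex.Im (vdz (fun q => toC (Phi q)) q i 0)) p 1 =
    grad (fun q => grad Phi q 1 i 0 * (- 2^-1)) p 1.
  apply: near_eq_derive; apply: filterS (near_disk dp) => q dq.
  by rewrite E//= mulNr mulrN.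
rewrite (D 0 2^-1) (D 1 (- 2^-1)) [in RHS]mxE.
have F (x y : R) : (x / 2 - y * - 2^-1) / 2 = (x + y) / 4 by field.
exact: F.
Qed.

(** Since [Phi_(z zbar)] is a quarter of the Laplacian, [H] is half the trace of the second
    fundamental form; this real form is the one that gets differentiated and enters the Weingarten
    equation. *)
Lemma meanHE p : disk p -> meanH Phi p = (sff Phi p 0 0 + sff Phi p 1 1) / 2.
Proof.
move=> dp; rewrite /meanH /sff.
set z := dot _ _.
have -> : complex.Re (2 * (real_complex R (e2lambda Phi p)^-1) * z) =
  2 * (e2lambda Phi p)^-1 * complex.Re z.
  rewrite -(rmorph_nat (real_complex R) 2) -rmorphM.
  by case: z => a b; simpc.
rewrite Re_dot_toC; set w := \col_i _.
have -> : w = 4^-1 *: (grad (fun q => grad Phi q 0) p 0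
                       + grad (fun q => grad Phi q 1) p 1).
  by apply/matrixP => i j; rewrite ord1 mxE Re_laplacian// !mxE mulrC.
rewrite dotZl dotDl.
have F (e x y : R) : 2 * e * (4^-1 * (x + y)) = (e * x + e * y) / 2 by field.
exact: F.
Qed.

Lemma derivable_e2lambda p k : disk p -> derivable (e2lambda Phi) p (dir R k).
Proof.
move=> dp; have H := is_derive_grad 0 k dp.
by have [] := is_derive_dot H H.
Qed.

Lemma is_derive_normal p k : disk p ->
  is_derive p (dir R k) (normal Phi) (grad (normal Phi) p k).
Proof.
move=> dp; apply/derivableP.
have [H0 _] := is_derive_grad 0 k dp.
have [H1 _] := is_derive_grad 1 k dp.
have DE := derivableV (e2lambda_neq0 dp) (@derivable_e2lambda p k dp).
by have [] := is_derive_scalemx (derivableP DE) (derivableP (derivable_cross H0 H1)).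
Qed.

Lemma is_derive_meanH p k : disk p ->
  is_derive p (dir R k) (meanH Phi) (grad (meanH Phi) p k).
Proof.
move=> dp; apply/derivableP.
have D l : derivable (fun q => sff Phi q l l) p (dir R k).
  have DE := derivableV (e2lambda_neq0 dp) (@derivable_e2lambda p k dp).
  have DH : derivable (fun q => grad (fun q => grad Phi q l) q l) p (dir R k).
    exact/diff_derivable/differentiable_hess.
  have [Dd _] := is_derive_dot (derivableP DH) (is_derive_normal k dp).
  exact: derivableM DE Dd.
apply: (@near_eq_derivable _ _ _ (2^-1 \*: ((fun q => sff Phi q 0 0)
  + (fun q => sff Phi q 1 1)))).
  by apply: filterS _ (near_disk dp) => q dq; rewrite meanHE//= mulrC.
by apply: derivableZ; apply: derivableD.
Qed.

End Surface.

(** * Antisymmetric products of two vectors, by blocks *)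

Lemma wedge_col_mx (K : comNzRingType) m (a b : 'cV[K]_m) (a1 a2 b1 b2 : K) :
  col_mx a (col_mx a1%:M a2%:M : 'cV_(1 + 1))
    *m (col_mx b (col_mx b1%:M b2%:M : 'cV_(1 + 1)))^T
  - col_mx b (col_mx b1%:M b2%:M : 'cV_(1 + 1))
    *m (col_mx a (col_mx a1%:M a2%:M : 'cV_(1 + 1)))^T =
  block_mx (a *m b^T - b *m a^T)
    (row_mx (b1 *: a - a1 *: b) (b2 *: a - a2 *: b))
    (col_mx (- (b1 *: a - a1 *: b)^T) (- (b2 *: a - a2 *: b)^T))
    (block_mx 0 (a1 * b2 - b1 * a2)%:M (- (a1 * b2 - b1 * a2)%:M) 0).
Proof.
rewrite !tr_col_mx !mul_col_row opp_block_mx add_block_mx; congr block_mx.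
- by rewrite !tr_scalar_mx !mul_mx_row !mul_mx_scalar opp_row_mx add_row_mx.
- rewrite !mul_col_mx !mul_scalar_mx opp_col_mx add_col_mx.
  by congr col_mx; apply/matrixP => i j; rewrite !mxE; ring.
rewrite !tr_scalar_mx -!scalar_mxM opp_block_mx add_block_mx.
rewrite -!raddfN -!raddfD /= (mulrC a1 b1) (mulrC a2 b2) !subrr raddf0.
by congr block_mx; congr (_%:M); ring.
Qed.

(** By the triple product formula, [a *m b^T - b *m a^T] sends [x] to [cross (cross b a) x], and the
    matrix on the right is that of [x |-> cross v x]. *)
Lemma wedge_cross (K : comNzRingType) c (a b : 'cV[K]_3) :
  let v := cross b (c *: a) in
  c *: (a *m b^T - b *m a^T) =
  \matrix_(i, j) nth 0 (nth [::] [:: [:: 0; - v 2 0; v 1 0];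
                                     [:: v 2 0; 0; - v 0 0];
                                     [:: - v 1 0; v 0 0; 0]] i) j.
Proof.
move=> v; apply/matrixP => i j; rewrite !mxE !big_ord1 !mxE.
by elim/ord3P: i; elim/ord3P: j; rewrite /v /= ?mxE /= ?mxE; ring.
Qed.

(** * The Weingarten equation and the conserved quantities at a point *)

Section Frame.
Variables (R : realType) (Phi : R * R -> 'cV[R]_3).
Hypothesis hPhi : conformal_immersion Phi.
Variable p : R * R.
Hypothesis dp : disk p.
Implicit Type k : 'I_2.

Let a := grad Phi p 0.
Let b := grad Phi p 1.
Let n := normal Phi p.
Let H := meanH Phi p.

(* Otherwise unification unfolds derivatives into limits before failing. *)
Local Opaque grad.

Lemma dot_normal_grad q k : dot (normal Phi q) (grad Phi q k) = 0.
Proof.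
by elim/ord2P: k; rewrite dotZl; [rewrite dot_crossl|rewrite dot_crossr]; rewrite mulr0.
Qed.

Lemma dot_normal_A0grad k : dot n (A0grad Phi p k) = 0.
Proof.
have W (c d : R) (m u v : 'cV[R]_3) : dot m u = 0 -> dot m v = 0 ->
    dot m (c *: u + d *: v) = 0.
  by move=> mu mv; rewrite dotDr !dotZr mu mv !mulr0 addr0.
exact: W (dot_normal_grad p 0) (dot_normal_grad p 1).
Qed.

Lemma dot_normal_normal q : disk q -> dot (normal Phi q) (normal Phi q) = 1.
Proof.
move=> dq; have E0 := e2lambda_neq0 hPhi dq.
have [_ _ /(_ q dq)[Eab ab0]] := hPhi.
exact: dot_conformal_normal E0 erefl (esym Eab) ab0.
Qed.

Lemma dot_dnormal_normal k : dot (grad (normal Phi) p k) n = 0.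
Proof.
have D := is_derive_normal hPhi k dp.
have E : 'D_(dir R k) (fun q => dot (normal Phi q) (normal Phi q)) p = 0.
  (* The normal is known to have unit length on the disk only, hence an equality near [p]. *)
  rewrite -[RHS](derive_cst (1 : R) p (dir R k)); apply: near_eq_derive.
  by apply: filterS (near_disk dp) => q dq; rewrite dot_normal_normal.
have := @derive_val _ _ _ _ _ _ _ (is_derive_dot D D).
by rewrite E (dotC (normal Phi p)) -/n; lra.
Qed.

(** Differentiate the orthogonality of the normal to [grad Phi q k] in direction [l]. That
    orthogonality holds at every [q], so the inner product is the zero function. *)
Lemma dot_dnormal_grad k l :
  dot (grad (normal Phi) p l) (grad Phi p k) = - (e2lambda Phi p * sff Phi p k l).
Proof.
have E : 'D_(dir R l) (fun q => dot (normal Phi q) (grad Phi q k)) p = 0.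
  rewrite -[RHS](derive_cst (0 : R) p (dir R l)); congr derive.
  by apply/funext => q; rewrite dot_normal_grad.
have := @derive_val _ _ _ _ _ _ _
  (is_derive_dot (is_derive_normal hPhi l dp) (is_derive_grad hPhi k l dp)).
rewrite E /sff (dotC (normal Phi p)) mulVKf; last exact: e2lambda_neq0.
by move=> e; apply/eqP; rewrite -addr_eq0 -e.
Qed.

Lemma A0grad0 : A0grad Phi p 0 =
  ((sff Phi p 0 0 - sff Phi p 1 1) / 2) *: a + sff Phi p 0 1 *: b.
Proof. by rewrite /A0grad !mxE. Qed.

Lemma A0grad1 : A0grad Phi p 1 =
  sff Phi p 0 1 *: a + ((sff Phi p 1 1 - sff Phi p 0 0) / 2) *: b.
Proof. by rewrite /A0grad !mxE. Qed.

Lemma sff_sym : sff Phi p 1 0 = sff Phi p 0 1.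
Proof. by rewrite /sff (hess_sym hPhi dp). Qed.

Local Opaque sff meanH.

(** The derivative of a unit vector is tangential, and [dot_dnormal_grad] gives its components in
    the conformal frame. *)
Lemma grad_normal_sff k :
  grad (normal Phi) p k = (- sff Phi p 0 k) *: a + (- sff Phi p 1 k) *: b.
Proof.
have E0 := e2lambda_neq0 hPhi dp.
have [_ _ /(_ p dp)[Eab ab0]] := hPhi.
have N c d : - (c * d) = c * - d :> R by rewrite mulrN.
have nab : dot (grad (normal Phi) p k) (cross a b) = 0.
  have := dot_dnormal_normal k; rewrite /n /normal dotZr => /eqP.
  by rewrite mulf_eq0 invr_eq0 (negPf E0) => /eqP.
exact: (conformal_frame_expansion E0 erefl (esym Eab) ab0 nab
  (etrans (dot_dnormal_grad 0 k) (N _ _)) (etrans (dot_dnormal_grad 1 k) (N _ _))).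
Qed.

(** Splits the second fundamental form into its trace part, which gives [H], and its tracefree part,
    which gives [A0grad]; [W0] and [W1] are the two rows. *)
Lemma weingarten k :
  grad (normal Phi) p k = - (H *: grad Phi p k + A0grad Phi p k).
Proof.
have W0 (x y z : R) (u v : 'cV[R]_3) : (- x) *: u + (- y) *: v =
    - (((x + z) / 2) *: u + (((x - z) / 2) *: u + y *: v)).
  by apply: cV3_eq; rewrite !mxE; field.
have W1 (x y z : R) (u v : 'cV[R]_3) : (- y) *: u + (- z) *: v =
    - (((x + z) / 2) *: v + (y *: u + ((z - x) / 2) *: v)).
  by apply: cV3_eq; rewrite !mxE; field.
rewrite grad_normal_sff /H (meanHE hPhi dp).
elim/ord2P: k; first by rewrite A0grad0 sff_sym; exact: W0.
by rewrite A0grad1; exact: W1.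
Qed.

Lemma cross_normal_grad k : cross n (grad Phi p k) = - gradperp Phi p k.
Proof.
have E0 := e2lambda_neq0 hPhi dp.
have [_ _ /(_ p dp)[Eab ab0]] := hPhi.
have [na nb] := cross_conformal_frame E0 erefl (esym Eab) ab0.
by elim/ord2P: k; rewrite /gradperp /= ?opprK; [exact: na|exact: nb].
Qed.

(** A quarter turn commutes with the trace part of the second fundamental form and anticommutes with
    the tracefree symmetric part; hence the opposite sign of [A0grad] compared with [weingarten]. *)
Lemma gradperp_normal k : gradperp (normal Phi) p k =
  cross n (H *: grad Phi p k - A0grad Phi p k).
Proof.
have na : cross n a = b by rewrite (cross_normal_grad 0) /gradperp /= opprK.
have nb : cross n b = - a by rewrite (cross_normal_grad 1).
have W0 (x y z : R) (m u v : 'cV[R]_3) : cross m u = v -> cross m v = - u ->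
    - ((- y) *: u + (- z) *: v) =
    cross m (((x + z) / 2) *: u - (((x - z) / 2) *: u + y *: v)).
  move=> mu mv; rewrite crossDr crossNr crossDr !crossZr mu mv.
  by apply: cV3_eq; rewrite !mxE; field.
have W1 (x y z : R) (m u v : 'cV[R]_3) : cross m u = v -> cross m v = - u ->
    (- x) *: u + (- y) *: v =
    cross m (((x + z) / 2) *: v - (y *: u + ((z - x) / 2) *: v)).
  move=> mu mv; rewrite crossDr crossNr crossDr !crossZr mu mv.
  by apply: cV3_eq; rewrite !mxE; field.
rewrite /H (meanHE hPhi dp) /gradperp; elim/ord2P: k => /=.
  by rewrite A0grad0 grad_normal_sff; exact: W0.
by rewrite A0grad1 grad_normal_sff sff_sym; exact: W1.
Qed.

Lemma grad_gaussY k :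
  let dH := grad (meanH Phi) p k in
  let w := A0grad Phi p k in
  let s := dot (Phi p) (Phi p) in
  grad (gaussY Phi) p k =
  col_mx (dH *: Phi p - w)
    (col_mx (dH * ((s - 1) / 2) - dot w (Phi p))%:M
            (dH * ((s + 1) / 2) - dot w (Phi p))%:M).
Proof.
move=> dH w s.
have DP := is_derive_Phi hPhi k dp; have Dn := is_derive_normal hPhi k dp.
have DH := is_derive_meanH hPhi k dp.
(* Taken at [c = -1] and [c = 1], this covers the last two entries of the first column of
   [gaussY]. *)
have Ds c : is_derive p (dir R k) (fun q => (dot (Phi q) (Phi q) + c) / 2)
    (dot (grad Phi p k) (Phi p)).
  have D2 := is_deriveD (is_derive_dot DP DP) (is_derive_cst c p (dir R k)).
  have -> : (fun q => (dot (Phi q) (Phi q) + c) / 2) =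
    2^-1 \*: ((fun q => dot (Phi q) (Phi q)) + cst c).
    by apply/funext => q; rewrite /= mulrC.
  apply: is_derive_eq.
  by rewrite addr0 (dotC (Phi p)) /GRing.scale /=; field.
have Dq := is_derive_scalar_mx1 (is_derive_dot Dn DP).
have := is_deriveD (is_derive_scalemx DH (is_derive_col_mx DP (is_derive_col_mx
  (is_derive_scalar_mx1 (Ds (- 1))) (is_derive_scalar_mx1 (Ds 1)))))
  (is_derive_col_mx Dn (is_derive_col_mx Dq Dq)).
move/(@derive_val _ _ _ _ _ _ _) => E; transitivity ('D_(dir R k) (gaussY Phi) p) => //.
rewrite [LHS]E.
(* In the last two entries, [H <grad Phi, Phi>] cancels against the Weingarten expansion of
   [<grad n, Phi>], while [<n, grad Phi>] vanishes. *)
rewrite !scale_col_mx !add_col_mx weingarten dot_normal_grad.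
rewrite dotNl dotDl dotZl !scale_scalar_mx -!raddfD /= -/w -/dH -/s -/H.
have V (u v w' : 'cV[R]_3) : u + v - (v + w') = u - w' by rewrite opprD addrA addrK.
have S (x y z : R) : x + y + (- (y + z) + 0) = x - z by ring.
by rewrite V !S.
Qed.

Lemma gaussYE :
  let s := dot (Phi p) (Phi p) in
  gaussY Phi p = col_mx (H *: Phi p + n)
   (col_mx (H * ((s - 1) / 2) + dot n (Phi p))%:M
           (H * ((s + 1) / 2) + dot n (Phi p))%:M).
Proof.
by move=> s; rewrite /gaussY !scale_col_mx !add_col_mx !scale_scalar_mx -!raddfD.
Qed.

Lemma VtraE k : Vtra Phi p k =
  - (2 *: (grad (meanH Phi) p k *: n + H *: A0grad Phi p k)).
Proof.
have nn : dot n n = 1 := dot_normal_normal dp.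
rewrite /Vtra /proj_line -/n nn divr1.
have -> : grad (vecH Phi) p k =
    grad (meanH Phi) p k *: n + H *: grad (normal Phi) p k.
  by have [_ D] := is_derive_scalemx (is_derive_meanH hPhi k dp)
    (is_derive_normal hPhi k dp).
rewrite dotDl (dotZl _ n) nn (dotZl H) dot_dnormal_normal mulr0 addr0 mulr1.
(* On tangent vectors, [cross n] followed by the cross product with [n] on the right is the
   identity. *)
have C x : dot n x = 0 -> cross (cross n x) (H *: n) = H *: x.
  move=> nx; rewrite crossZr crossC triple_product nn nx.
  by rewrite scale0r scale1r sub0r opprK.
have W (c d : R) (m t w : 'cV[R]_3) :
    c *: m + d *: - (d *: t + w) - 3 *: (c *: m) + d *: (d *: t - w) =
    - (2 *: (c *: m + d *: w)).
  by apply: cV3_eq; rewrite !mxE; ring.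
rewrite gradperp_normal C; last first.
  by rewrite dotDr dotZr -scaleN1r dotZr dot_normal_A0grad dot_normal_grad !mulr0 addr0.
by rewrite weingarten; exact: W.
Qed.

Let dH k := grad (meanH Phi) p k.
Let s := dot (Phi p) (Phi p).

Lemma Vrot_tildeE k : Vrot_tilde Phi p k =
  cross (H *: Phi p + n) (2 *: (dH k *: Phi p - A0grad Phi p k)).
Proof.
(* The two terms in [cross m t] cancel; what remains of [2 *: gradperp n] is [- 2 *: cross m w], the
   term needed for the right-hand side to factor. *)
have W (c d : R) (f m t w : 'cV[R]_3) :
    cross f (- (2 *: (c *: m + d *: w))) + (2 * d) *: - cross m t
      + 2 *: cross m (d *: t - w) = cross (d *: f + m) (2 *: (c *: f - w)).
  by apply: cV3_eq; rewrite !mxE /=; ring.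
have -> : Vrot_tilde Phi p k =
    cross (Phi p) (Vtra Phi p k) + (2 * H) *: - - gradperp Phi p k
    + 2 *: gradperp (normal Phi) p k by rewrite opprK.
by rewrite VtraE -cross_normal_grad gradperp_normal; exact: W.
Qed.

Lemma Vdil_gaussY k : Vdil Phi p k =
  2 * ((dH k * ((s - 1) / 2) - dot (A0grad Phi p k) (Phi p))
         * (H * ((s + 1) / 2) + dot n (Phi p))
       - (H * ((s - 1) / 2) + dot n (Phi p))
         * (dH k * ((s + 1) / 2) - dot (A0grad Phi p k) (Phi p))).
Proof.
(* In both columns of this 2 by 2 minor the two entries differ by the factor of [Phi], [d] or [c],
   so the terms in [dot f f] cancel. *)
have W (c d : R) (f m w : 'cV[R]_3) : dot (- (2 *: (c *: m + d *: w))) f =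
  2 * ((c * ((dot f f - 1) / 2) - dot w f) * (d * ((dot f f + 1) / 2) + dot m f)
     - (d * ((dot f f - 1) / 2) + dot m f) * (c * ((dot f f + 1) / 2) - dot w f)).
  by rewrite dotNl dotZl dotDl !dotZl; field.
by rewrite /Vdil VtraE; exact: W.
Qed.

Lemma Vtra_sub_Vinv k : - (2^-1 *: (Vtra Phi p k - Vinv Phi p k)) =
  2 *: ((H * ((s - 1) / 2) + dot n (Phi p)) *: (dH k *: Phi p - A0grad Phi p k)
    - (dH k * ((s - 1) / 2) - dot (A0grad Phi p k) (Phi p)) *: (H *: Phi p + n)).
Proof.
have W (c d : R) (f m w : 'cV[R]_3) : let v := - (2 *: (c *: m + d *: w)) in
    - (2^-1 *: (v - (dot f f *: v - (2 * dot v f) *: f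
        + 4 *: cross f (cross m w)))) =
    2 *: ((d * ((dot f f - 1) / 2) + dot m f) *: (c *: f - w)
    - (c * ((dot f f - 1) / 2) - dot w f) *: (d *: f + m)).
  (* Once the double cross product is expanded, both sides are combinations of [f], [m], [w] whose
     coefficients are polynomials in inner products, kept as atoms for [field]. *)
  move=> v; rewrite triple_product /v dotNl dotZl dotDl !dotZl (dotC f m) (dotC f w).
  by apply: cV3_eq; rewrite !mxE; field.
by rewrite /Vinv /Vdil VtraE; exact: W.
Qed.

Lemma Vtra_add_Vinv k : 2^-1 *: (Vtra Phi p k + Vinv Phi p k) =
  2 *: ((H * ((s + 1) / 2) + dot n (Phi p)) *: (dH k *: Phi p - A0grad Phi p k)
    - (dH k * ((s + 1) / 2) - dot (A0grad Phi p k) (Phi p)) *: (H *: Phi p + n)).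
Proof.
have W (c d : R) (f m w : 'cV[R]_3) : let v := - (2 *: (c *: m + d *: w)) in
    2^-1 *: (v + (dot f f *: v - (2 * dot v f) *: f
        + 4 *: cross f (cross m w))) =
    2 *: ((d * ((dot f f + 1) / 2) + dot m f) *: (c *: f - w)
    - (c * ((dot f f + 1) / 2) - dot w f) *: (d *: f + m)).
  move=> v; rewrite triple_product /v dotNl dotZl dotDl !dotZl (dotC f m) (dotC f w).
  by apply: cV3_eq; rewrite !mxE; field.
by rewrite /Vinv /Vdil VtraE; exact: W.
Qed.

End Frame.

Theorem theorem1p4 (R : realType) (Phi : R * R -> 'cV[R]_3)
  (hPhi : conformal_immersion Phi) (hW : willmore Phi)
  (p : R * R) (hp : disk p) (k : 'I_2) :
  2 *: mu Phi p k =
  (block_mx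
     (Umx Phi p k)
     (row_mx (- (2^-1 *: (Vtra Phi p k - Vinv Phi p k)))
             (2^-1 *: (Vtra Phi p k + Vinv Phi p k)))
     (col_mx (2^-1 *: (Vtra Phi p k - Vinv Phi p k))^T
             (- (2^-1 *: (Vinv Phi p k + Vtra Phi p k))^T))
     (block_mx 0 (Vdil Phi p k)%:M
               (- (Vdil Phi p k)%:M) 0) : 'M[R]_(3 + (1 + 1))).
Proof.
(* The explicit sizes make the 5 by 5 matrix be read as having blocks of sizes [3] and [1 + 1]. *)
rewrite /mu grad_gaussY// gaussYE; rewrite [X in 2 *: X](@wedge_col_mx R 3).
rewrite [LHS](@scale_block_mx R 3 (1 + 1) 3 (1 + 1)) scale_row_mx scale_col_mx.
rewrite scale_block_mx.
(* The lower left blocks are put in the form, up to sign and transpose, that the identities for the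
   upper right blocks rewrite. *)
rewrite (addrC (Vinv Phi p k)) -[_ *: (Vtra Phi p k - _)]opprK.
rewrite Vtra_sub_Vinv// Vtra_add_Vinv// Vdil_gaussY//.
rewrite !scalerN !scaler0 !scale_scalar_mx -!linearZ /=.
have trN (X : 'cV[R]_3) : (- X)^T = - X^T by rewrite linearN.
by rewrite wedge_cross /Umx Vrot_tildeE// opprK trN.
Qed.
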